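(* Suppose $u$ is a classical solution, with pressure $p$, to the Navier-Stokes equation on $\mathbb{R}^3$, $$\partial_tu-\Delta u+(u\cdot\nabla)u+\nabla p=0,\qquad\nabla\cdot u=0.$$ Then $S=\nabla_{sym}(u)$ is a classical solution to the Navier-Stokes strain equation $$\partial_tS+(u\cdot\nabla)S-\Delta S+S^2+\frac14\,\omega\otimes\omega-\frac14|\omega|^2I_3+\operatorname{Hess}(p)=0.$$
   Context: Here $u$ takes values in $\mathbb{R}^3$, $(\nabla_{sym}u)_{ij}=\frac12\left(\frac{\partial u_j}{\partial x_i}+\frac{\partial u_i}{\partial x_j}\right)$, $\omega=\nabla\times u$ is the vorticity, $(\omega\otimes\omega)_{ij}=\omega_i\omega_j$, $I_3$ is the $3\times3$ identity matrix, $\operatorname{Hess}(p)$ is the matrix of second spatial derivatives of $p$, $S^2$ is the matrix square, and $(u\cdot\nabla)S$ and $\Delta S$ act entrywise. ''Classical solution'' means that $u$ and $p$ are regular enough that all derivatives appearing in the equations exist in the classical sense and the equations hold pointwise. *)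

(* Defs.v *)
From HB Require Import structures.
From mathcomp Require Import all_boot all_order all_algebra.
From mathcomp Require Import all_classical all_reals all_analysis.
Import Order.TTheory GRing.Theory Num.Theory.
Import numFieldNormedType.Exports.

Set Implicit Arguments.
Unset Strict Implicit.
Unset Printing Implicit Defensive.

Local Open Scope classical_set_scope.
Local Open Scope ring_scope.

(* Time-dependent fields on R^3 are functions R -> 'rV[R]_3 -> V of the time t
   and the point x.  For V = 'rV[R]_3 or 'M[R]_3, where a limit is a limit of
   every entry, the operators below act entrywise. *)

Section Regularity.
Context {R : realType} {V : normedModType R}.
Implicit Types (J : set R) (f : R -> 'rV[R]_3 -> V) (i : 'I_3).

Definition dt f (t : R) (x : 'rV[R]_3) : V := derive1 (fun s => f s x) t.

Definition dx i f (t : R) (x : 'rV[R]_3) : V :=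
  'D_(delta_mx 0 i : 'rV[R]_3) (f t) x.

(* [derive] is total, so the existence of a derivative is always a separate
   condition.  J is meant to be an open set of times. *)

Definition continuous_on J f : Prop :=
  forall t x, J t ->
    {for (t, x), continuous (fun z : R * 'rV[R]_3 => f z.1 z.2)}.

Definition C1_time J f : Prop :=
  (forall t x, J t -> derivable (fun s => f s x) t 1) /\
  continuous_on J (dt f).

(* All the spatial derivatives of orders 1, ..., k exist and are continuous in
   (t, x).  Nothing is said of f itself: a pressure may be discontinuous in
   time. *)
Fixpoint Ck_space (k : nat) J f : Prop :=
  if k is k'.+1 then
    forall i, [/\ forall t x, J t ->
                    derivable (f t) x (delta_mx 0 i : 'rV[R]_3),
                  continuous_on J (dx i f)
                & Ck_space k' J (dx i f)]
  else True.

Definition laplacian f (t : R) (x : 'rV[R]_3) : V :=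
  \sum_(i < 3) dx i (dx i f) t x.

Definition advection (u : R -> 'rV[R]_3 -> 'rV[R]_3) f
    (t : R) (x : 'rV[R]_3) : V :=
  \sum_(i < 3) u t x 0 i *: dx i f t x.

End Regularity.

Section VectorCalculus.
Context {R : realType}.
Implicit Types (p : R -> 'rV[R]_3 -> R) (u : R -> 'rV[R]_3 -> 'rV[R]_3).

Definition grad p (t : R) (x : 'rV[R]_3) : 'rV[R]_3 := \row_i dx i p t x.

Definition hess p (t : R) (x : 'rV[R]_3) : 'M[R]_3 :=
  \matrix_(i, j) dx i (dx j p) t x.

Definition divergence u (t : R) (x : 'rV[R]_3) : R :=
  \sum_(i < 3) dx i u t x 0 i.

(* 'I_3 carries addition modulo 3:
   (curl u)_i = d_(i+1) u_(i+2) - d_(i+2) u_(i+1) with cyclic indices. *)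
Definition curl u (t : R) (x : 'rV[R]_3) : 'rV[R]_3 :=
  \row_(i < 3) (dx (i + 1) u t x 0 (i + 2) - dx (i + 2) u t x 0 (i + 1)).

Definition nabla_sym u (t : R) (x : 'rV[R]_3) : 'M[R]_3 :=
  \matrix_(i, j) (2^-1 * (dx i u t x 0 j + dx j u t x 0 i)).

Definition outer (v w : 'rV[R]_3) : 'M[R]_3 := \matrix_(i, j) (v 0 i * w 0 j).

(* The norm `|v| of 'rV[R]_3 is the sup norm, not the Euclidean one. *)
Definition sqnorm (v : 'rV[R]_3) : R := \sum_(i < 3) v 0 i ^+ 2.

Definition NS_classical (J : set R) u p : Prop :=
  [/\ [/\ continuous_on J u, C1_time J u, Ck_space 2 J u & Ck_space 1 J p],
      forall t x, J t ->
        dt u t x - laplacian u t x + advection u u t x + grad p t x = 0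
    & forall t x, J t -> divergence u t x = 0].

Definition strain_classical (J : set R) u p (S : R -> 'rV[R]_3 -> 'M[R]_3) :
    Prop :=
  [/\ continuous_on J u /\ Ck_space 1 J u,
      [/\ continuous_on J S, C1_time J S & Ck_space 2 J S],
      Ck_space 2 J p
    & forall t x, J t ->
        dt S t x + advection u S t x - laplacian S t x + S t x ^+ 2
        + 4^-1 *: outer (curl u t x) (curl u t x)
        - (4^-1 * sqnorm (curl u t x))%:M + hess p t x = 0].

End VectorCalculus.

(* Main.v *)
Require Import Defs.
From mathcomp Require Import all_boot all_order all_algebra.
From mathcomp Require Import all_classical all_reals all_analysis.
From mathcomp Require Import ring lra.
Import Order.TTheory GRing.Theory Num.Theory.
Import numFieldNormedType.Exports.

Set Implicit Arguments.
Unset Strict Implicit.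
Unset Printing Implicit Defensive.

Local Open Scope classical_set_scope.
Local Open Scope ring_scope.

(** Differentiating the momentum equation in [x_k] and symmetrizing gives the
strain equation, once the derivatives may be exchanged.

The pointwise computation.  Taking d_k of the [j]-th momentum equation turns
the transport term into the transport of [d_k u_j] plus the quadratic term
sum_i d_k u_i d_i u_j, an entry of the square of the gradient matrix.  After
averaging over (k, j) and (j, k) the linear terms are those of the strain
equation, the pressure contributes its symmetric Hessian, and what is left is
the symmetric part of the square of the gradient.  Writing the gradient as its
symmetric part S plus its antisymmetric part A, this is S^2 + A^2; as A is,
up to sign, the cross product with half of the vorticity w, A^2 is a quarter
of w w^T - |w|^2 I ([gradient_sq_sym]).

The exchange of derivatives.  Nothing is assumed on the derivatives of [u]
mixing time and space, so even the differentiability of [nabla_sym u] in time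
has to be proved.  The momentum equation itself provides it: [dt u] equals
[laplacian u - advection u u - grad p], which is C1 in space because [u] is C3
and [p] is C2.  Peano's form of the theorem on mixed derivatives
([is_derive_mixed]) then gives both the existence of [dt (dx k u)] and its
value [dx k (dt u)], because it requires only one of the two mixed derivatives
to exist and be continuous.  The same theorem, used at a fixed time with one
space direction in the role of time, makes the spatial derivatives commute
([dx_dx]).

All of this is carried out on scalar fields, the entries of [u] and of its
gradient; continuity and differentiability pass between a matrix-valued field
and its entries. *)

(** * Mixed derivatives *)

Section MixedDerivatives.
Context {R : realType} {V : normedModType R}.

Lemma growth_rate_line (W : normedModType R) (f : V -> W) (x v : V) (s : R) :
  (fun h : R => h^-1 *: (((fun r : R => f (r *: v + x)) \o shift s) (h *: 1)
                         - f (s *: v + x))) =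
  (fun h : R => h^-1 *: ((f \o shift (s *: v + x)) (h *: v)
                         - f (s *: v + x))).
Proof.
apply/funext => h /=.
by rewrite scalerDl addrA /GRing.scale/= mulr1.
Qed.

Lemma derive_line (W : normedModType R) (f : V -> W) (x v : V) (s : R) :
  'D_1 (fun r : R => f (r *: v + x)) s = 'D_v f (s *: v + x).
Proof. by rewrite /derive growth_rate_line. Qed.

Lemma derivable_line (W : normedModType R) (f : V -> W) (x v : V) (s : R) :
  derivable (fun r : R => f (r *: v + x)) s 1 <-> derivable f (s *: v + x) v.
Proof. by rewrite /derivable growth_rate_line. Qed.

Lemma growth_rate_shiftl (W : normedModType R) (f : V -> W) (w x v : V) :
  (fun h : R => h^-1 *: (((fun y => f (w + y)) \o shift x) (h *: v)
                         - f (w + x))) =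
  (fun h : R => h^-1 *: ((f \o shift (w + x)) (h *: v) - f (w + x))).
Proof. by apply/funext => h /=; rewrite addrCA. Qed.

Lemma derive_shiftl (W : normedModType R) (f : V -> W) (w x v : V) :
  'D_v (fun y => f (w + y)) x = 'D_v f (w + x).
Proof. by rewrite /derive growth_rate_shiftl. Qed.

Lemma derivable_shiftl (W : normedModType R) (f : V -> W) (w x v : V) :
  derivable (fun y => f (w + y)) x v <-> derivable f (w + x) v.
Proof. by rewrite /derivable growth_rate_shiftl. Qed.

(** The mean value theorem along a line, in a form insensitive to the sign of
the step [k]: both increments of a second difference may be negative. *)
Lemma mean_value_dir (f : V -> R) (x v : V) (k : R) :
  (forall c : R, `|c| <= `|k| -> derivable f (c *: v + x) v) ->
  exists2 c, `|c| <= `|k| & f (k *: v + x) - f x = k * 'D_v f (c *: v + x).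
Proof.
move=> df; pose g (r : R) := f (r *: v + x).
have dg (c : R) : `|c| <= `|k| -> is_derive c 1 g ('D_v f (c *: v + x)).
  move=> /df dfc; apply: DeriveDef; last exact: derive_line.
  exact/derivable_line.
have gcont (a b : R) : (forall c : R, c \in `[a, b] -> `|c| <= `|k|) ->
    {within `[a, b], continuous g}.
  move=> ab; apply: derivable_within_continuous => c /ab /dg dc.
  exact: ex_derive.
have -> : f x = g 0 by rewrite /g scale0r add0r.
rewrite -/(g k); have [k0|k0] := leP 0 k.
- have sub (c : R) : c \in `[0, k] -> `|c| <= `|k|.
    by rewrite in_itv/= => /andP[c0 ck]; rewrite !ger0_norm.
  have [||c c0k] := @MVT_segment _ g (fun c => 'D_v f (c *: v + x)) 0 k k0.
    by move=> c c0k; apply/dg/sub; exact: subset_itv_oo_cc.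
    exact: gcont.
  rewrite subr0 mulrC => gE; exists c => //; exact: sub.
- have sub (c : R) : c \in `[k, 0] -> `|c| <= `|k|.
    by rewrite in_itv/= => /andP[kc c0]; rewrite !ler0_norm ?lerN2// ltW.
  have [||c c0k] :=
    @MVT_segment _ g (fun c => 'D_v f (c *: v + x)) k 0 (ltW k0).
    by move=> c c0k; apply/dg/sub; exact: subset_itv_oo_cc.
    exact: gcont.
  move=> gE; exists c; first exact: sub.
  by rewrite -opprB gE sub0r mulrN opprK mulrC.
Qed.

End MixedDerivatives.

(** Peano's theorem.  The second difference of [f] over the box with sides [h]
and [k v] is, by the mean value theorem in [s] and then in the direction [v],
equal to [h k] times the mixed derivative taken in the order time, space at a
point of the box.  Letting [k] tend to 0 first turns the second difference
into the increment of ['D_v (f s) x] between [a] and [a + h]; so the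
difference quotient of the latter stays close to the mixed derivative. *)
Lemma is_derive_mixed (R : realType) (V : normedModType R) (f : R -> V -> R)
    (v : V) (a : R) (x : V) :
  (\forall z \near (a, x), derivable (f^~ z.2) z.1 1) ->
  (\forall z \near (a, x), derivable (fun y => 'D_1 (f^~ y) z.1) z.2 v) ->
  (\forall s \near a, derivable (f s) x v) ->
  {for (a, x), continuous (fun z => 'D_v (fun y => 'D_1 (f^~ y) z.1) z.2)} ->
  is_derive a 1 (fun s => 'D_v (f s) x) ('D_v (fun y => 'D_1 (f^~ y) a) x).
Proof.
move=> ft ftx fx fcont; set L := 'D_v _ x.
suff DL : (h^-1 *: (((fun s => 'D_v (f s) x) \o shift a) (h *: 1)
            - 'D_v (f a) x)) @[h --> 0^'] --> L.
  by apply: DeriveDef; [apply/cvg_ex; exists L | exact: cvg_lim].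
apply/cvgrPdist_le => e e0.
have fe : \forall z \near (a, x),
    `|L - 'D_v (fun y => 'D_1 (f^~ y) z.1) z.2| <= e.
  by move/cvgrPdist_le : fcont => /(_ _ e0).
have [d /= d0 dP] := (nbhs_ballP _ _).1 (filterI ft (filterI ftx fe)).
have [d' /= d'0 d'P] := (nbhs_ballP _ _).1 fx.
pose m := Num.min d d'.
have m0 : 0 < m by rewrite lt_min d0.
near=> h.
have h0 : h != 0 by near: h; exact: nbhs_dnbhs_neq.
have hm : `|h| < m by near: h; exact: dnbhs0_lt.
have hd : `|h| < d by apply: lt_le_trans hm _; rewrite ge_min lexx.
have hd' : `|h| < d' by apply: lt_le_trans hm _; rewrite ge_min lexx orbT.
rewrite /= [h *: 1]mulr1.
have fxha : derivable (f (h + a)) x v.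
  by apply: d'P; rewrite /ball/= opprD addrCA subrr addr0 normrN.
have fxa : derivable (f a) x v by apply: d'P; exact: ballxx.
pose q k := h^-1 * (k^-1 * (f (h + a) (k *: v + x) - f (h + a) x)
                   - k^-1 * (f a (k *: v + x) - f a x)).
have qcvg : q k @[k --> 0^'] --> h^-1 * ('D_v (f (h + a)) x - 'D_v (f a) x).
  by apply: cvgMr; apply: cvgB; [exact: fxha | exact: fxa].
(* The inner limit k -> 0, at a fixed step h. *)
apply: (@cvgr_to_le _ (0^' : set_system R) _ _ (fun k => `|L - q k|)).
  by apply: cvg_norm; apply: cvgB qcvg; exact: cvg_cst.
near=> k.
have k0 : k != 0 by near: k; exact: nbhs_dnbhs_neq.
have kd : `|k| * `|v| < d.
  (* The added 1 covers v = 0. *)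
  have : `|k| < d / (`|v| + 1).
    by near: k; apply: dnbhs0_lt; rewrite divr_gt0// ltr_wpDl.
  rewrite ltr_pdivlMr ?ltr_wpDl//; apply: le_lt_trans.
  by rewrite ler_wpM2l// lerDl.
have box (s c : R) : `|s| <= `|h| -> `|c| <= `|k| ->
    ball (a, x) d (s + a, c *: v + x).
  move=> sh ck; split => /=.
    rewrite /ball/= opprD addrCA subrr addr0 normrN.
    exact: le_lt_trans hd.
  rewrite -ball_normE /ball_/= opprD addrCA subrr addr0 normrN normrZ.
  by apply: le_lt_trans kd; rewrite ler_wpM2r.
have [s sh sE] : exists2 s, `|s| <= `|h| &
    (f (h + a) (k *: v + x) - f (h + a) x) - (f a (k *: v + x) - f a x) =
    h * ('D_1 (f^~ (k *: v + x)) (s + a) - 'D_1 (f^~ x) (s + a)).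
  pose g s := f s (k *: v + x) - f s x.
  have dg (s : R) : `|s| <= `|h| -> is_derive (s + a) 1 g
      ('D_1 (f^~ (k *: v + x)) (s + a) - 'D_1 (f^~ x) (s + a)).
    move=> sh; apply: is_deriveB; apply: derivableP.
      by have [] := dP _ (box s k sh (lexx _)).
    have := dP _ (box s 0 sh _); rewrite scale0r add0r normr0 => -[]//.
  have [s sh|s sh] := @mean_value_dir _ _ g a 1 h.
    by rewrite [s *: 1]mulr1; have [] := dg _ sh.
  rewrite [h *: 1]mulr1 [s *: 1]mulr1 => gE; exists s => //.
  by rewrite -[RHS]/(_ * _) -(derive_val (is_derive := dg s sh)) -gE.
have [c ck cE] : exists2 c, `|c| <= `|k| &
    'D_1 (f^~ (k *: v + x)) (s + a) - 'D_1 (f^~ x) (s + a) =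
    k * 'D_v (fun y => 'D_1 (f^~ y) (s + a)) (c *: v + x).
  apply: (@mean_value_dir _ _ (fun y => 'D_1 (f^~ y) (s + a))) => c ck.
  by have [_ []] := dP _ (box _ _ sh ck).
have -> : q k = 'D_v (fun y => 'D_1 (f^~ y) (s + a)) (c *: v + x).
  by rewrite /q -mulrBr sE cE [k^-1 * _]mulrCA mulKf// mulKf.
by have [_ []] := dP _ (box _ _ sh ck).
Unshelve. all: end_near. Qed.

(** * Calculus of time-dependent fields *)

Section FieldCalculus.
Context {R : realType} {V : normedModType R}.
Implicit Types (J : set R) (f g : R -> 'rV[R]_3 -> V) (i : 'I_3).

Lemma dx_eq f g i (t : R) x : f t =1 g t -> dx i f t x = dx i g t x.
Proof. by rewrite /dx => /funext ->. Qed.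

(** Openness of [J] enters here: an identity valid at the times in [J] holds in
a neighbourhood of each point of the space-time slab, hence may be used under
limits in (t, x). *)
Lemma near_time J t (x : 'rV[R]_3) (P : R -> 'rV[R]_3 -> Prop) :
  open J -> J t -> (forall s y, J s -> P s y) ->
  \forall z \near (t, x), P z.1 z.2.
Proof.
move=> Jo Jt JP; have : \forall z \near (t, x), J z.1.
  by apply: (cvg_fst _); exact: open_nbhs_nbhs.
by apply: filterS => z; exact: JP.
Qed.

Lemma eq_continuous_on J f g : open J -> (forall t x, J t -> f t x = g t x) ->
  continuous_on J f -> continuous_on J g.
Proof.
move=> Jo fg fc t x Jt; rewrite /prop_for/continuous_at/= -fg//.
apply: cvg_trans (fc t x Jt); apply: near_eq_cvg.
exact: (near_time x Jo Jt fg).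
Qed.

Lemma eq_Ck_space k J f g : open J -> (forall t x, J t -> f t x = g t x) ->
  Ck_space k J f -> Ck_space k J g.
Proof.
move=> Jo; elim: k f g => [//|k IH] f g fg fk i; have [df cf kf] := fk i.
have dfg t x : J t -> dx i f t x = dx i g t x.
  by move=> Jt; apply: dx_eq => y; exact: fg.
split; [|exact: eq_continuous_on cf|exact: IH kf].
move=> t x Jt; rewrite -(_ : f t = g t); first exact: df.
by apply/funext => y; exact: fg.
Qed.

Lemma Ck_spaceS k J f : Ck_space k.+1 J f -> Ck_space k J f.
Proof.
elim: k f => [//|k IH] f fk i; have [df cf kf] := fk i; split => //.
exact: IH.
Qed.

Lemma Ck_space_derivable k J f i t x : Ck_space k.+1 J f -> J t ->
  derivable (f t) x (delta_mx 0 i : 'rV[R]_3).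
Proof. by move=> fk; have [+ _ _] := fk i; exact. Qed.

Lemma continuous_onD J f g : continuous_on J f -> continuous_on J g ->
  continuous_on J (fun t x => f t x + g t x).
Proof. by move=> fc gc t x Jt; apply: cvgD; [exact: fc|exact: gc]. Qed.

Lemma continuous_onZ J (a : R) f : continuous_on J f ->
  continuous_on J (fun t x => a *: f t x).
Proof. by move=> fc t x Jt; apply: cvgZr; exact: fc. Qed.

Arguments Ck_space_derivable {k J f} i {t} x _ _.
Arguments continuous_onD {J f g} _ _.
Arguments continuous_onZ {J} a {f} _.

Lemma dxD i f g t x : derivable (f t) x (delta_mx 0 i : 'rV[R]_3) ->
  derivable (g t) x (delta_mx 0 i : 'rV[R]_3) ->
  dx i (fun t x => f t x + g t x) t x = dx i f t x + dx i g t x.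
Proof. exact: deriveD. Qed.

Lemma dxZ i (a : R) f t x : derivable (f t) x (delta_mx 0 i : 'rV[R]_3) ->
  dx i (fun t x => a *: f t x) t x = a *: dx i f t x.
Proof. exact: deriveZ. Qed.

Lemma Ck_spaceD k J f g : open J -> Ck_space k J f -> Ck_space k J g ->
  Ck_space k J (fun t x => f t x + g t x).
Proof.
move=> Jo; elim: k f g => [//|k IH] f g fk gk i.
have [df cf kf] := fk i; have [dg cg kg] := gk i.
have E t x : J t ->
    dx i f t x + dx i g t x = dx i (fun t x => f t x + g t x) t x.
  by move=> Jt; rewrite dxD//; [exact: df|exact: dg].
split; first by move=> t x Jt; apply: derivableD; [exact: df|exact: dg].
  exact: (eq_continuous_on Jo E (continuous_onD cf cg)).
exact: eq_Ck_space Jo E (IH _ _ kf kg).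
Qed.

Lemma Ck_spaceZ k J (a : R) f : open J -> Ck_space k J f ->
  Ck_space k J (fun t x => a *: f t x).
Proof.
move=> Jo; elim: k f => [//|k IH] f fk i; have [df cf kf] := fk i.
have E t x : J t -> a *: dx i f t x = dx i (fun t x => a *: f t x) t x.
  by move=> Jt; rewrite dxZ//; exact: df.
split; first by move=> t x Jt; apply: derivableZ; exact: df.
  exact: (eq_continuous_on Jo E (continuous_onZ a cf)).
exact: eq_Ck_space Jo E (IH _ kf).
Qed.

Lemma dxB i f g t x : derivable (f t) x (delta_mx 0 i : 'rV[R]_3) ->
  derivable (g t) x (delta_mx 0 i : 'rV[R]_3) ->
  dx i (fun t x => f t x - g t x) t x = dx i f t x - dx i g t x.
Proof. exact: deriveB. Qed.

Lemma Ck_spaceB k J f g : open J -> Ck_space k J f -> Ck_space k J g ->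
  Ck_space k J (fun t x => f t x - g t x).
Proof.
move=> Jo fk gk.
apply: (eq_Ck_space Jo _ (Ck_spaceD Jo fk (Ck_spaceZ (-1) Jo gk))) => t x _.
by rewrite scaleN1r.
Qed.

Lemma eq_dx J f g i t x : (forall t x, J t -> f t x = g t x) -> J t ->
  dx i f t x = dx i g t x.
Proof. by move=> fg Jt; apply: dx_eq => y; exact: fg. Qed.

Lemma near_eq_time J f g t x : open J -> (forall t x, J t -> f t x = g t x) ->
  J t -> {near t, (fun s => f s x) =1 (fun s => g s x)}.
Proof.
move=> Jo fg Jt; apply: filterS (open_nbhs_nbhs (conj Jo Jt)) => s Js.
exact: fg.
Qed.

Lemma eq_dt J f g t x : open J -> (forall t x, J t -> f t x = g t x) -> J t ->
  dt f t x = dt g t x.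
Proof.
move=> Jo fg Jt; rewrite /dt !derive1E; apply: near_eq_derive.
exact: near_eq_time fg Jt.
Qed.

Lemma eq_C1_time J f g : open J -> (forall t x, J t -> f t x = g t x) ->
  C1_time J f -> C1_time J g.
Proof.
move=> Jo fg [df cf]; split=> [t x Jt|].
  exact: near_eq_derivable (near_eq_time x Jo fg Jt) (df t x Jt).
by apply: (eq_continuous_on Jo _ cf) => t x Jt; exact: eq_dt fg Jt.
Qed.

Lemma dtD f g t x : derivable (fun s => f s x) t 1 ->
  derivable (fun s => g s x) t 1 ->
  dt (fun t x => f t x + g t x) t x = dt f t x + dt g t x.
Proof. by move=> df dg; rewrite /dt !derive1E deriveD. Qed.

Lemma dtZ (a : R) f t x : derivable (fun s => f s x) t 1 ->
  dt (fun t x => a *: f t x) t x = a *: dt f t x.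
Proof. by move=> df; rewrite /dt !derive1E deriveZ. Qed.

Lemma Ck_space_cst k J (c : V) : Ck_space k J (fun _ _ => c).
Proof.
elim: k c => [//|k IH] c i.
have -> : dx i (fun _ _ => c) = fun _ _ => 0.
  by apply/funext => t; apply/funext => x; exact: derive_cst.
by split=> [t x Jt|t x Jt|]; [exact: derivable_cst|exact: cvg_cst|exact: IH].
Qed.

Lemma Ck_space_sum n k J (F : 'I_n -> R -> 'rV[R]_3 -> V) : open J ->
  (forall l, Ck_space k J (F l)) ->
  Ck_space k J (fun t x => \sum_(l < n) F l t x).
Proof.
move=> Jo; elim: n F => [|n IH] F Fk.
  apply: (eq_Ck_space Jo _ (Ck_space_cst k J 0)) => t x _.
  by rewrite big_ord0.
have Fk' l := Fk (widen_ord (leqnSn n) l).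
apply: (eq_Ck_space Jo _ (Ck_spaceD Jo (IH _ Fk') (Fk ord_max))) => t x _.
by rewrite big_ord_recr.
Qed.

Lemma dx_sum n i (F : 'I_n -> R -> 'rV[R]_3 -> V) t x :
  (forall l, derivable (F l t) x (delta_mx 0 i : 'rV[R]_3)) ->
  dx i (fun t x => \sum_(l < n) F l t x) t x = \sum_(l < n) dx i (F l) t x.
Proof.
move=> dF; rewrite /dx -derive_sum//; congr ('D_ _ _ x).
by apply/funext => y; rewrite fct_sumE.
Qed.

Lemma C1_timeD J f g : open J -> C1_time J f -> C1_time J g ->
  C1_time J (fun t x => f t x + g t x).
Proof.
move=> Jo [df cf] [dg cg]; split.
  by move=> t x Jt; apply: derivableD; [exact: df|exact: dg].
apply: (eq_continuous_on Jo _ (continuous_onD cf cg)) => t x Jt.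
by rewrite dtD//; [exact: df|exact: dg].
Qed.

Lemma C1_timeZ J (a : R) f : open J -> C1_time J f ->
  C1_time J (fun t x => a *: f t x).
Proof.
move=> Jo [df cf]; split.
  by move=> t x Jt; apply: derivableZ; exact: df.
apply: (eq_continuous_on Jo _ (continuous_onZ a cf)) => t x Jt.
by rewrite dtZ//; exact: df.
Qed.

End FieldCalculus.

Arguments Ck_space_derivable {R V k J f} i {t} x _ _.
Arguments continuous_onD {R V J f g} _ _.
Arguments continuous_onZ {R V J} a {f} _.

(** * Fields and their entries *)

Section MatrixFields.
Context {R : realType} {m n : nat}.
Implicit Types (J : set R) (f : R -> 'rV[R]_3 -> 'M[R]_(m, n)).

Definition entry f (a : 'I_m) (b : 'I_n) : R -> 'rV[R]_3 -> R :=
  fun t x => f t x a b.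

Lemma continuous_on_mxP J f :
  continuous_on J f <-> forall a b, continuous_on J (entry f a b).
Proof.
split=> [fc a b t x Jt|fc t x Jt].
  apply: (@continuous_comp _ _ _ (fun z : R * 'rV[R]_3 => f z.1 z.2)
    (fun M : 'M[R]_(m, n) => M a b)); first exact: fc.
  exact: coord_continuous.
apply/cvgrPdist_le => e e0; near=> z.
rewrite [leLHS]/Num.Def.normr/= mx_normrE (bigmax_le _ (ltW e0))//= => i _.
rewrite !mxE; move: i; near: z; apply: filter_forall => -[a b] /=.
by have /cvgrPdist_le := fc a b t x Jt; exact.
Unshelve. all: by end_near. Qed.

Lemma dt_entry f a b t x : derivable (fun s => f s x) t 1 ->
  dt (entry f a b) t x = dt f t x a b.
Proof. by move=> df; rewrite /dt !derive1E derive_mx// mxE. Qed.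

Lemma dx_entry f a b i t x :
  derivable (f t) x (delta_mx 0 i : 'rV[R]_3) ->
  dx i (entry f a b) t x = dx i f t x a b.
Proof. by move=> df; rewrite /dx derive_mx// mxE. Qed.

Lemma C1_time_mxP J f : open J ->
  C1_time J f <-> forall a b, C1_time J (entry f a b).
Proof.
move=> Jo; split=> [[df cf] a b|fc].
  split=> [t x Jt|]; first exact: (derivable_mxP _ _ _).1 (df t x Jt) a b.
  apply: eq_continuous_on Jo _ ((continuous_on_mxP _ _).1 cf a b) => t x Jt.
  by rewrite dt_entry//; exact: df.
have df t x : J t -> derivable (fun s => f s x) t 1.
  by move=> Jt; apply/derivable_mxP => a b; exact: (fc a b).1.
split; [exact: df|apply/continuous_on_mxP => a b].
apply: eq_continuous_on Jo _ (fc a b).2 => t x Jt.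
by rewrite dt_entry//; exact: df.
Qed.

Lemma Ck_space_mxP k J f : open J ->
  Ck_space k J f <-> forall a b, Ck_space k J (entry f a b).
Proof.
move=> Jo; elim: k f => [//|k IH] f; split=> [fk a b i|fk i].
  have [df cf kf] := fk i.
  have E t x : J t -> entry (dx i f) a b t x = dx i (entry f a b) t x.
    by move=> Jt; rewrite dx_entry//; exact: df.
  split=> [t x Jt||].
  - exact: (derivable_mxP _ _ _).1 (df t x Jt) a b.
  - exact: eq_continuous_on Jo E ((continuous_on_mxP _ _).1 cf a b).
  - exact: eq_Ck_space Jo E ((IH _).1 kf a b).
have df t x : J t -> derivable (f t) x (delta_mx 0 i : 'rV[R]_3).
  by move=> Jt; apply/derivable_mxP => a b; have [+ _ _] := fk a b i; exact.
have E a b t x : J t -> dx i (entry f a b) t x = entry (dx i f) a b t x.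
  by move=> Jt; rewrite dx_entry//; exact: df.
split; first exact: df.
  apply/continuous_on_mxP => a b; have [_ cf _] := fk a b i.
  exact: eq_continuous_on Jo (E a b) cf.
apply/IH => a b; have [_ _ kf] := fk a b i.
exact: eq_Ck_space Jo (E a b) kf.
Qed.

End MatrixFields.

(** * Exchanging derivatives of scalar fields *)

Section ScalarFields.
Context {R : realType}.
Implicit Types (J : set R) (f g : R -> 'rV[R]_3 -> R) (i j : 'I_3).

Lemma dxM i f g t x : derivable (f t) x (delta_mx 0 i : 'rV[R]_3) ->
  derivable (g t) x (delta_mx 0 i : 'rV[R]_3) ->
  dx i (fun t x => f t x * g t x) t x = f t x * dx i g t x + g t x * dx i f t x.
Proof. exact: deriveM. Qed.

Lemma Ck_space1M J f g : open J -> continuous_on J f -> continuous_on J g ->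
  Ck_space 1 J f -> Ck_space 1 J g -> Ck_space 1 J (fun t x => f t x * g t x).
Proof.
move=> Jo cf cg f1 g1 i; have [df cdf _] := f1 i; have [dg cdg _] := g1 i.
split=> [t x Jt||//]; first exact: derivableM (df t x Jt) (dg t x Jt).
apply: (@eq_continuous_on _ _ J
  (fun t x => f t x * dx i g t x + g t x * dx i f t x)) => //.
  by move=> t x Jt; rewrite dxM; [|exact: df|exact: dg].
by apply: continuous_onD => t x Jt; apply: cvgM;
  [exact: cf|exact: cdg|exact: cg|exact: cdf].
Qed.

(** Only the derivative [dx i (dt f)] is known to exist and to be continuous;
the other mixed derivative is produced. *)
Lemma is_derive_dt_dx J f i t x : open J -> C1_time J f -> Ck_space 1 J f ->
  Ck_space 1 J (dt f) -> J t ->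
  is_derive t 1 (fun s => dx i f s x) (dx i (dt f) t x).
Proof.
move=> Jo [df _] f1 ft1 Jt; have [dxf _ _] := f1 i; have [dxft cft _] := ft1 i.
have dtE : dt f = fun s y => 'D_1 (f^~ y) s.
  by apply/funext => s; apply/funext => y; rewrite /dt derive1E.
rewrite dtE in dxft cft *.
apply: is_derive_mixed.
- exact: (@near_time _ J t x (fun s y => derivable (f^~ y) s 1)).
- exact: near_time dxft.
- by apply: filterS (open_nbhs_nbhs (conj Jo Jt)) => s; exact: dxf.
- exact: cft.
Qed.

Lemma dt_dx J f i t x : open J -> C1_time J f -> Ck_space 1 J f ->
  Ck_space 1 J (dt f) -> J t -> dt (dx i f) t x = dx i (dt f) t x.
Proof.
move=> Jo f1 f2 f3 Jt; rewrite {1}/dt derive1E.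
by have [] := is_derive_dt_dx i x Jo f1 f2 f3 Jt.
Qed.

Lemma C1_time_dx J f i : open J -> C1_time J f -> Ck_space 1 J f ->
  Ck_space 1 J (dt f) -> C1_time J (dx i f).
Proof.
move=> Jo f1 f2 f3; split=> [t x Jt|].
  by have [] := is_derive_dt_dx i x Jo f1 f2 f3 Jt.
have [_ c _] := f3 i; apply: (eq_continuous_on Jo _ c) => t x Jt.
by rewrite (dt_dx _ _ Jo).
Qed.

(** Along the direction [e i], [f t] becomes the one-parameter family
[g s y = f t (s e_i + y)], whose derivative in [s] is [dx i f]; the statement
is then [is_derive_mixed] at [s = 0]. *)
Lemma dx_dx J f i j t x : Ck_space 2 J f -> J t ->
  dx i (dx j f) t x = dx j (dx i f) t x.
Proof.
move=> f2 Jt; pose e k : 'rV[R]_3 := delta_mx 0 k.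
pose g (s : R) (y : 'rV[R]_3) := f t (s *: e i + y).
have [di ci1 fi1] := f2 i; have [dj _ fj1] := f2 j.
have [dij cij _] := fi1 j.
have gsE s : (fun y => 'D_1 (g^~ y) s) = fun y => dx i f t (s *: e i + y).
  by apply/funext => y; exact: derive_line.
have gjE s y : 'D_(e j) (g s) y = dx j f t (s *: e i + y).
  exact: derive_shiftl.
have : is_derive (0 : R) 1 (fun s => 'D_(e j) (g s) x)
    ('D_(e j) (fun y => 'D_1 (g^~ y) 0) x).
  apply: is_derive_mixed.
  - by apply: filterE => -[s y] /=; apply/derivable_line; exact: di.
  - apply: filterE => -[s y] /=; rewrite gsE.
    by apply/derivable_shiftl; exact: dij.
  - by apply: filterE => s; apply/derivable_shiftl; exact: dj.
  - have -> : (fun z : R * 'rV[R]_3 => 'D_(e j) (fun y => 'D_1 (g^~ y) z.1) z.2)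
        = (fun z => dx j (dx i f) z.1 z.2) \o (fun z => (t, z.1 *: e i + z.2)).
      apply/funext => -[s y] /=; rewrite gsE; exact: derive_shiftl.
    apply: continuous_comp; last exact: cij.
    have cl : (fun z : R * 'rV[R]_3 => z.1 *: e i + z.2) @ nbhs ((0 : R), x) -->
        (0 : R) *: e i + x.
      apply: cvgD; last exact: cvg_snd.
      by apply: cvgZ; [exact: cvg_fst|exact: cvg_cst].
    have ct : (fun=> t) @ nbhs ((0 : R), x) --> t by exact: cvg_cst.
    exact: (cvg_pair ct cl).
under eq_fun do rewrite gjE.
move=> [_]; rewrite derive_line scale0r add0r => dE.
rewrite [LHS]dE gsE derive_shiftl scale0r add0r.
exact: erefl.
Qed.

End ScalarFields.

(** * The symmetric part of the squared gradient *)

Lemma sum3 (V : nmodType) (F : 'I_3 -> V) : \sum_(i < 3) F i = F 0 + F 1 + F 2.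
Proof.
rewrite !big_ord_recr big_ord0 /= add0r.
by congr (F _ + F _ + F _); apply/val_inj.
Qed.

(** With [G = S + A], [S] symmetric and [A] antisymmetric, the symmetric part of
[G^2] is [S^2 + A^2], the cross terms [S A + A S] being antisymmetric.  The
entries of [A] are those of [w / 2] up to sign, and the square of the cross
product with [w] is [w w^T - |w|^2 I].  In three dimensions this is checked on
each of the nine entries. *)
Lemma gradient_sq_sym (R : realFieldType) (G : 'I_3 -> 'I_3 -> R) (k j : 'I_3) :
  let S a b := 2^-1 * (G a b + G b a) in
  let w a := G (a + 1) (a + 2) - G (a + 2) (a + 1) in
  2^-1 * (\sum_(i < 3) G k i * G i j + \sum_(i < 3) G j i * G i k) =
  \sum_(i < 3) S k i * S i j + 4^-1 * (w k * w j)
  - (4^-1 * \sum_(i < 3) w i ^+ 2) *+ (k == j).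
Proof.
move=> S w; rewrite !sum3.
have w0 : w 0 = G 1 2 - G 2 1 by rewrite /w !add0r.
have w1 : w 1 = G 2 0 - G 0 2.
  rewrite /w (_ : 1 + 1 = 2 :> 'I_3) 1?(_ : 1 + 2 = 0 :> 'I_3)//;
  exact/val_inj.
have w2 : w 2 = G 0 1 - G 1 0.
  rewrite /w (_ : 2 + 1 = 0 :> 'I_3) 1?(_ : 2 + 2 = 1 :> 'I_3)//;
  exact/val_inj.
have I3 (a : 'I_3) : [\/ a = 0, a = 1 | a = 2].
  by case: a => [[|[|[|//]]] lt3];
    [apply: Or31|apply: Or32|apply: Or33]; apply/val_inj.
have n01 : ((0 : 'I_3) == 1) = false by [].
have n02 : ((0 : 'I_3) == 2) = false by [].
have n12 : ((1 : 'I_3) == 2) = false by [].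
by have [] := I3 k => ->; have [] := I3 j => ->;
  rewrite ?eqxx ?n01 ?n02 ?n12 1?eq_sym ?n01 ?n02 ?n12 w0 w1 w2 /S
    ?mulr0n ?mulr1n; field.
Qed.

(** The terms of the [(k, j)] entry of the strain equation: [l], [g], [v] stand
for the Laplacian, quadratic and transport terms of the two gradient entries
averaged, [q] for the Hessian of the pressure, and [s + o - n] for the three
quadratic terms in the strain and the vorticity. *)
Lemma strain_terms_cancel (R : realFieldType)
    (l1 l2 g1 g2 v1 v2 q s o n : R) : 2^-1 * (g1 + g2) = s + o - n ->
  2^-1 * (l1 - (g1 + v1) - q + (l2 - (g2 + v2) - q))
  + 2^-1 * (v1 + v2) - 2^-1 * (l1 + l2) + s + o - n + q = 0.
Proof. by move=> alg; lra. Qed.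

(** * The strain equation *)

Unset Implicit Arguments.

Section StrainEquation.
Context {R : realType} (J : set R) (Jo : open J).
Context (u : R -> 'rV[R]_3 -> 'rV[R]_3) (p : R -> 'rV[R]_3 -> R).
Context (u_C3 : Ck_space 3 J u) (p_C2 : Ck_space 2 J p).
Context (NS : NS_classical J u p).

Let U (a : 'I_3) := entry u 0 a.

Let U_C3 a : Ck_space 3 J (U a).
Proof. exact: (Ck_space_mxP 3 u Jo).1 u_C3 0 a. Qed.

Let U_C1 a : Ck_space 1 J (U a).
Proof. exact: (Ck_spaceS (Ck_spaceS (U_C3 a))). Qed.

Let U_cont a : continuous_on J (U a).
Proof.
by have [[cu _ _ _] _ _] := NS; exact: (continuous_on_mxP J u).1 cu 0 a.
Qed.

Let U_C1_time a : C1_time J (U a).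
Proof. by have [[_ cu _ _] _ _] := NS; exact: (C1_time_mxP u Jo).1 cu 0 a. Qed.

Let dU_C2 i a : Ck_space 2 J (dx i (U a)).
Proof. by have [] := U_C3 a i. Qed.

Let dU_C1 i a : Ck_space 1 J (dx i (U a)).
Proof. exact: (Ck_spaceS (dU_C2 i a)). Qed.

Let ddU_C1 i j a : Ck_space 1 J (dx i (dx j (U a))).
Proof. by have [] := dU_C2 j a i. Qed.

Let dU_cont i a : continuous_on J (dx i (U a)).
Proof. by have [] := U_C3 a i. Qed.

Let dp_C1 i : Ck_space 1 J (dx i p).
Proof. by have [] := p_C2 i. Qed.

Let dxu i a t x : J t -> dx i u t x 0 a = dx i (U a) t x.
Proof. by move=> Jt; rewrite -dx_entry//; have [+ _ _] := u_C3 i; exact. Qed.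

Let dxdxu i j a t x : J t -> dx i (dx j u) t x 0 a = dx i (dx j (U a)) t x.
Proof.
move=> Jt; have [_ _ /(_ i)[ddu _ _]] := u_C3 j.
rewrite -dx_entry; last exact: ddu.
by apply: (@eq_dx _ _ J) => // s y Js; exact: dxu.
Qed.

Let momentum_rhs a t x : R :=
  \sum_(i < 3) dx i (dx i (U a)) t x
  - \sum_(i < 3) U i t x * dx i (U a) t x - dx a p t x.

Let dtU_momentum a t x : J t -> dt (U a) t x = momentum_rhs a t x.
Proof.
move=> Jt; have [[_ [du _] _ _] /(_ t x Jt) + _] := NS.
move=> /matrixP/(_ 0 a); rewrite !mxE !summxE dt_entry; last exact: du.
rewrite /momentum_rhs.
under eq_bigr do rewrite dxdxu//.
under [X in _ + X + _]eq_bigr do rewrite mxE dxu//.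
set d := dt u t x 0 a; set l := \sum_(i < 3) _; set v := \sum_(i < 3) _.
by move: d l v (dx a p t x) => d l v q eq0; lra.
Qed.

Let UdU_C1 i a : Ck_space 1 J (fun t x => U i t x * dx i (U a) t x).
Proof.
exact: (Ck_space1M Jo (U_cont i) (dU_cont i a) (U_C1 i) (dU_C1 i a)).
Qed.

Let lap_C1 a : Ck_space 1 J (fun t x => \sum_(i < 3) dx i (dx i (U a)) t x).
Proof. exact: (Ck_space_sum Jo (fun i => ddU_C1 i i a)). Qed.

Let adv_C1 a : Ck_space 1 J (fun t x => \sum_(i < 3) U i t x * dx i (U a) t x).
Proof. exact: (Ck_space_sum Jo (fun i => UdU_C1 i a)). Qed.

Let momentum_rhs_C1 a : Ck_space 1 J (momentum_rhs a).
Proof.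
exact: (Ck_spaceB Jo (Ck_spaceB Jo (lap_C1 a) (adv_C1 a)) (dp_C1 a)).
Qed.

(** The gain that makes the strain differentiable in time: the momentum equation
transfers the spatial regularity of [u] and [p] to [dt u]. *)
Let dtU_C1 a : Ck_space 1 J (dt (U a)).
Proof.
apply: (eq_Ck_space Jo _ (momentum_rhs_C1 a)) => t x Jt.
by rewrite dtU_momentum.
Qed.

Let dx3_comm i k a t x : J t ->
  dx i (dx i (dx k (U a))) t x = dx k (dx i (dx i (U a))) t x.
Proof.
move=> Jt; rewrite -(dx_dx i k x (dU_C2 i a) Jt).
apply: eq_dx Jt => s y Js; exact: (dx_dx i k y (Ck_spaceS (U_C3 a)) Js).
Qed.

Let dx_dtU k a t x : J t -> dx k (dt (U a)) t x =
  \sum_(i < 3) dx k (dx i (dx i (U a))) t x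
  - (\sum_(i < 3) dx k (U i) t x * dx i (U a) t x
     + \sum_(i < 3) U i t x * dx i (dx k (U a)) t x)
  - dx k (dx a p) t x.
Proof.
move=> Jt; rewrite (eq_dx k x (dtU_momentum a) Jt).
have dlap := Ck_space_derivable k x (lap_C1 a) Jt.
have dadv := Ck_space_derivable k x (adv_C1 a) Jt.
have dp := Ck_space_derivable k x (dp_C1 a) Jt.
rewrite dxB; [|exact: derivableB dlap dadv|exact: dp].
rewrite dxB; [|exact: dlap|exact: dadv].
rewrite dx_sum; last first.
  by move=> i; exact: (Ck_space_derivable k x (ddU_C1 i i a) Jt).
rewrite dx_sum; last first.
  by move=> i; exact: (Ck_space_derivable k x (UdU_C1 i a) Jt).
have -> : \sum_(i < 3) dx k (fun t x => U i t x * dx i (U a) t x) t x =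
    \sum_(i < 3) dx k (U i) t x * dx i (U a) t x
    + \sum_(i < 3) U i t x * dx i (dx k (U a)) t x.
  rewrite -big_split; apply: eq_bigr => i _.
  rewrite dxM; [|exact: (Ck_space_derivable k x (U_C1 i) Jt)
                |exact: (Ck_space_derivable k x (dU_C1 i a) Jt)].
  rewrite addrC (dx_dx k i x (Ck_spaceS (U_C3 a)) Jt).
  by rewrite [X in X + _]mulrC.
exact: erefl.
Qed.

(** The entries of [nabla_sym u] as combinations of scalar fields, to which the
closure properties of regular fields apply. *)
Let strain k j t x : R := 2^-1 *: (dx k (U j) t x + dx j (U k) t x).

Let strainE k j t x : J t -> strain k j t x = entry (nabla_sym u) k j t x.
Proof.
move=> Jt; rewrite /entry mxE.
exact: (congr2 (fun a b => 2^-1 * (a + b))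
  (esym (dxu k j t x Jt)) (esym (dxu j k t x Jt))).
Qed.

Lemma strain_continuous : continuous_on J (nabla_sym u).
Proof.
apply/continuous_on_mxP => k j.
apply: (eq_continuous_on Jo (strainE k j)).
exact: (continuous_onZ _ (continuous_onD (dU_cont k j) (dU_cont j k))).
Qed.

Let strain_entry_C2 k j : Ck_space 2 J (strain k j).
Proof. exact: (Ck_spaceZ _ Jo (Ck_spaceD Jo (dU_C2 k j) (dU_C2 j k))). Qed.

Let entry_strain_C2 k j : Ck_space 2 J (entry (nabla_sym u) k j).
Proof. exact: (eq_Ck_space Jo (strainE k j) (strain_entry_C2 k j)). Qed.

Lemma strain_C2 : Ck_space 2 J (nabla_sym u).
Proof. exact: (Ck_space_mxP 2 (nabla_sym u) Jo).2 entry_strain_C2. Qed.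

Let dxU_C1_time k a : C1_time J (dx k (U a)).
Proof. exact: (C1_time_dx k Jo (U_C1_time a) (U_C1 a) (dtU_C1 a)). Qed.

Lemma strain_C1_time : C1_time J (nabla_sym u).
Proof.
apply/(C1_time_mxP _ Jo) => k j.
apply: (eq_C1_time Jo (strainE k j)).
exact: (C1_timeZ _ Jo (C1_timeD Jo (dxU_C1_time k j) (dxU_C1_time j k))).
Qed.

Let dt_strain k j t x : J t -> dt (nabla_sym u) t x k j =
  2^-1 * (dx k (dt (U j)) t x + dx j (dt (U k)) t x).
Proof.
move=> Jt; have dk := (dxU_C1_time k j).1 t x Jt.
have dj := (dxU_C1_time j k).1 t x Jt.
rewrite -dt_entry; last exact: strain_C1_time.1.
rewrite -(eq_dt x Jo (strainE k j) Jt) dtZ; last exact: derivableD dk dj.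
rewrite dtD; [|exact: dk|exact: dj].
by rewrite (dt_dx k x Jo (U_C1_time j) (U_C1 j) (dtU_C1 j) Jt)
  (dt_dx j x Jo (U_C1_time k) (U_C1 k) (dtU_C1 k) Jt).
Qed.

Let dx_strain i k j t x : J t ->
  dx i (nabla_sym u) t x k j =
  2^-1 * (dx i (dx k (U j)) t x + dx i (dx j (U k)) t x).
Proof.
move=> Jt; have dk := Ck_space_derivable i x (dU_C2 k j) Jt.
have dj := Ck_space_derivable i x (dU_C2 j k) Jt.
rewrite -dx_entry; last exact: (Ck_space_derivable i x strain_C2 Jt).
rewrite -(eq_dx i x (strainE k j) Jt) dxZ; last exact: derivableD dk dj.
by rewrite dxD; [|exact: dk|exact: dj].
Qed.

Let dxdx_strain i k j t x : J t ->
  dx i (dx i (nabla_sym u)) t x k j =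
  2^-1 * (dx k (dx i (dx i (U j))) t x + dx j (dx i (dx i (U k))) t x).
Proof.
move=> Jt; have dk := Ck_space_derivable i x (ddU_C1 i k j) Jt.
have dj := Ck_space_derivable i x (ddU_C1 i j k) Jt.
have [_ _ dS1] := strain_C2 i.
have dS : derivable (dx i (nabla_sym u) t) x (delta_mx 0 i : 'rV[R]_3).
  exact: (Ck_space_derivable i x (k := 0) dS1 Jt).
rewrite -(dx_entry k j dS).
have E s y : J s -> entry (dx i (nabla_sym u)) k j s y =
    2^-1 *: (dx i (dx k (U j)) s y + dx i (dx j (U k)) s y).
  exact: dx_strain.
rewrite (eq_dx i x E Jt) dxZ; last exact: derivableD dk dj.
rewrite dxD; [|exact: dk|exact: dj].
exact: (congr2 (fun a b => 2^-1 * (a + b))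
  (dx3_comm i k j t x Jt) (dx3_comm i j k t x Jt)).
Qed.

Lemma strain_equation t x : J t ->
  dt (nabla_sym u) t x + advection u (nabla_sym u) t x
  - laplacian (nabla_sym u) t x + nabla_sym u t x ^+ 2
  + 4^-1 *: outer (curl u t x) (curl u t x)
  - (4^-1 * sqnorm (curl u t x))%:M + hess p t x = 0.
Proof.
move=> Jt; apply/matrixP => k j.
pose G a b := dx a (U b) t x.
have entryE (D A L Q O H : 'M[R]_3) (c : R) :
    (D + A - L + Q + 4^-1 *: O - c%:M + H) k j =
    D k j + A k j - L k j + Q k j + 4^-1 * O k j - c *+ (k == j) + H k j.
  by rewrite !mxE.
have uG a b : dx a u t x 0 b = G a b := dxu a b t x Jt.
have curlE a : curl u t x 0 a = G (a + 1) (a + 2) - G (a + 2) (a + 1).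
  rewrite mxE; exact: (congr2 (fun a b => a - b) (uG _ _) (uG _ _)).
have strainG a b : nabla_sym u t x a b = 2^-1 * (G a b + G b a).
  exact: (esym (strainE a b t x Jt)).
have advE : advection u (nabla_sym u) t x k j =
    2^-1 * (\sum_(i < 3) U i t x * dx i (dx k (U j)) t x
            + \sum_(i < 3) U i t x * dx i (dx j (U k)) t x).
  rewrite /advection summxE -big_split mulr_sumr; apply: eq_bigr => i _.
  rewrite mxE (dx_strain i k j t x Jt) mulrCA mulrDr; exact: erefl.
have lapE : laplacian (nabla_sym u) t x k j =
    2^-1 * (\sum_(i < 3) dx k (dx i (dx i (U j))) t x
            + \sum_(i < 3) dx j (dx i (dx i (U k))) t x).
  rewrite /laplacian summxE -big_split mulr_sumr; apply: eq_bigr => i _.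
  exact: dxdx_strain.
have sqE : (nabla_sym u t x ^+ 2) k j =
    \sum_(i < 3) (2^-1 * (G k i + G i k)) * (2^-1 * (G i j + G j i)).
  rewrite expr2 -mulmxE mxE; apply: eq_bigr => i _.
  exact: (congr2 *%R (strainG k i) (strainG i j)).
have outerE : outer (curl u t x) (curl u t x) k j =
    (G (k + 1) (k + 2) - G (k + 2) (k + 1))
    * (G (j + 1) (j + 2) - G (j + 2) (j + 1)).
  by rewrite mxE !curlE.
have sqnormE : sqnorm (curl u t x) =
    \sum_(i < 3) (G (i + 1) (i + 2) - G (i + 2) (i + 1)) ^+ 2.
  by apply: eq_bigr => i _; rewrite curlE.
have hessE : hess p t x k j = dx k (dx j p) t x by rewrite mxE.
rewrite entryE advE lapE sqE outerE sqnormE hessE mxE.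
rewrite (dt_strain k j t x Jt) (dx_dtU k j t x Jt) (dx_dtU j k t x Jt).
rewrite (dx_dx j k x p_C2 Jt).
apply: strain_terms_cancel; exact: (gradient_sq_sym G k j).
Qed.

End StrainEquation.

Theorem proposition2p1 (R : realType) (J : set R) (J_open : open J)
    (u : R -> 'rV[R]_3 -> 'rV[R]_3) (p : R -> 'rV[R]_3 -> R)
    (u_C3 : Ck_space 3 J u) (p_C2 : Ck_space 2 J p)
    (NS : NS_classical J u p) :
  strain_classical J u p (nabla_sym u).
Proof.
have [[u_cont _ _ _] _ _] := NS; split.
- by split; [exact: u_cont|exact: (Ck_spaceS (Ck_spaceS u_C3))].
- split.
  + exact: (strain_continuous _ J_open _ u_C3).
  + exact: (strain_C1_time _ J_open _ _ u_C3 p_C2 NS).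
  + exact: (strain_C2 _ J_open _ u_C3).
- exact: p_C2.
- by move=> t x; exact: strain_equation.
Qed.
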